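(* Let $G_1$ and $G_2$ be bipartite graphs on $2n$ vertices, and let $0<p<2$. Then $$\mathcal{E}_{p}(G_1) -\mathcal{E}_{p}(G_2) = \frac{2p \sin \left(\frac{p \pi}{2}\right)}{\pi} \int_{0}^{\infty} z^{p-1} \log\left(\frac{\phi(G_1,iz)}{\phi(G_2,iz)} \right) dz.$$
   Context: Graphs are finite, simple and undirected. For a graph $G$ on $m$ vertices, $A_G$ is its adjacency matrix, $\lambda_1,\dots,\lambda_m$ are the eigenvalues of $A_G$ (real, listed with multiplicity), and $\phi(G,x)=\det(xI-A_G)=\prod_{j=1}^m(x-\lambda_j)$ is its characteristic polynomial, regarded as a polynomial in a complex variable $x$; $i$ is the imaginary unit. The $p$-Schatten energy of $G$ is $\mathcal{E}_p(G)=\sum_{j=1}^m|\lambda_j|^p$ (for $p>0$, with $0^p=0$). For bipartite $G_1,G_2$ on the same number $2n$ of vertices and real $z>0$, the ratio $\phi(G_1,iz)/\phi(G_2,iz)$ is a positive real number, and $\log$ is the real natural logarithm. *)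

(* Defs.v *)
(* MathComp world (MathComp-Analysis and real-closed). *)
From HB Require Import structures.
From mathcomp Require Import all_boot all_order all_algebra.
From mathcomp Require Import all_classical all_reals all_analysis.
From mathcomp Require Import polyrcf complex.

Set Implicit Arguments.
Unset Strict Implicit.
Unset Printing Implicit Defensive.

Import Order.TTheory GRing.Theory Num.Theory.
Import numFieldNormedType.Exports.

Local Open Scope ring_scope.

Record sgraph (V : finType) := SGraph {
  adj : rel V;
  adj_sym : symmetric adj;
  adj_irr : irreflexive adj
}.

Definition bipartite (V : finType) (G : sgraph V) : Prop :=
  exists A : {set V}, forall u v : V, adj G u v -> (u \in A) != (v \in A).

Definition adjmx (K : nzRingType) (V : finType) (G : sgraph V) : 'M[K]_#|V| :=
  \matrix_(i, j) (adj G (enum_val i) (enum_val j))%:R.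

Definition phi (R : realType) (V : finType) (G : sgraph V) : {poly R[i]} :=
  char_poly (adjmx R[i] G).

(* [rootsR] lists each real root once, so each is repeated [mup] times; no
   eigenvalue is lost because the adjacency matrix is real symmetric
   (see [char_poly_eigenvalues]). *)
Definition eigenvalues (R : realType) (V : finType) (G : sgraph V) : seq R :=
  let P := char_poly (adjmx R G) in
  flatten [seq nseq (mup l P) l | l <- rootsR P].

Definition schatten_energy (R : realType) (p : R) (V : finType) (G : sgraph V)
    : R :=
  \sum_(l <- eigenvalues R G) `|l| `^ p.

Section CharPolyEigenvalues.
Variables (R : realType) (V : finType) (G : sgraph V).
Let P := char_poly (adjmx R G).

Let phi_real : phi R G = map_poly (real_complex R) P.
Proof.
rewrite /phi /P map_char_poly; congr char_poly.
by apply/matrixP => i j; rewrite !mxE rmorph_nat.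
Qed.

Let P_splits : exists s : seq R, P = \prod_(l <- s) ('X - l%:P).
Proof.
have herm : adjmx R[i] G \is hermsymmx.
  apply: realsym_hermsym.
    apply/is_hermitianmxP; rewrite expr0 scale1r.
    by apply/matrixP => i j; rewrite !mxE adj_sym.
  by apply/mxOverP => i j; rewrite !mxE realn.
have /orthomx_spectralP A_eq := hermitian_normalmx herm.
have /mxOverP d_real := hermitian_spectral_diag_real herm.
set d := spectral_diag _ in A_eq d_real.
exists [seq complex.Re (d 0 i) | i <- enum 'I_#|V|].
apply: (map_poly_inj (real_complex R)); rewrite -phi_real.
rewrite big_map big_enum /= rmorph_prod /=.
under eq_bigr do rewrite map_polyXsubC /= RRe_real ?d_real//.
transitivity (char_poly (diag_mx d)).
  rewrite /phi A_eq; set Q := spectralmx _.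
  have Qu : Q \in unitmx by exact: spectral_unit.
  rewrite /char_poly; set D := diag_mx d.
  have -> : char_poly_mx (invmx Q *m D *m Q) =
      map_mx polyC (invmx Q) *m char_poly_mx D *m map_mx polyC Q.
    rewrite /char_poly_mx mulmxBr mulmxBl !map_mxM; congr (_ - _).
    by rewrite scalar_mxC -mulmxA -map_mxM mulVmx// map_mx1 mulmx1.
  rewrite !det_mulmx mulrAC -det_mulmx -map_mxM mulVmx//.
  by rewrite map_mx1 det1 mul1r.
rewrite char_poly_trig ?diag_mx_is_trig//.
by apply: eq_bigr => i _; rewrite mxE eqxx mulr1n.
Qed.

Lemma char_poly_eigenvalues :
  char_poly (adjmx R G) = \prod_(l <- eigenvalues R G) ('X - l%:P).
Proof.
have [s Ps] := P_splits; rewrite -/P {1}Ps; apply: perm_big.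
have P_neq0 : P != 0 by rewrite monic_neq0 ?char_poly_monic.
apply/allP => x _ /=; apply/eqP.
have <- : mup x P = count_mem x s by rewrite Ps mu_prod_XsubC.
rewrite /eigenvalues -/P count_flatten -map_comp.
under eq_map do rewrite /= count_nseq /=.
rewrite sumnE big_map.
have [xr|xr] := boolP (x \in rootsR P).
  rewrite (bigD1_seq x) ?uniq_roots//= eqxx mul1n big1 ?addn0// => l /negPf.
  by move=> ->.
rewrite big1_seq => [|l /andP[_ lr]].
  by rewrite mupNroot// -[root P x]andTb (roots_on_rootsR P_neq0).
by rewrite (_ : l == x = false)//; apply: contraNF xr => /eqP <-.
Qed.

End CharPolyEigenvalues.

(* Main.v *)
Require Import Defs.
From HB Require Import structures.
From mathcomp Require Import all_boot all_order all_algebra.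
From mathcomp Require Import all_classical all_reals all_analysis.
From mathcomp Require Import polyrcf complex.
From mathcomp Require Import measurable_realfun ring lra.

Set Implicit Arguments.
Unset Strict Implicit.
Unset Printing Implicit Defensive.

Import Order.TTheory GRing.Theory Num.Theory.
Import numFieldNormedType.Exports.

Local Open Scope ring_scope.

(** In a bipartite graph the eigenvalues come in pairs l, -l
    ([eigenvalues_opp]), so that phi (G, i z) is (i z)^(2n) times the square
    root of the product of the 1 + (l / z)^2 ([phi_imaginary]). In the ratio of
    two such values the powers of i z cancel ([phi_ratio]), and the integrand
    becomes half the difference, between the two graphs, of the sums over the
    eigenvalues of
      z^(p-1) ln (1 + (|l| / z)^2).
    Each of these functions is integrable on ]0, +oo[ for 0 < p < 2, and the
    theorem follows by linearity from the value of its integral,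
      |l|^p pi / (p sin (p pi / 2))          ([has_int_energy_kernel]).

    This integral is computed by cutting the half-line at a = |l|. On either
    side one expands ln (1 + y), with y = (z / a)^2 or y = (a / z)^2, to an order
    m with remainder at most y^(m+1) / (m+1) ([ln1p_taylor_bound]), and
    integrates powers of z. The outcome is that the integral divided by a^p
    differs by O(1 / m) from S_m / p, where S_m = [csc_sum (p / 2) m] is a partial
    sum of the expansion of pi / sin (s pi) into partial fractions at s = p / 2.

    It remains to identify the limit of S_m. By Cesaro's lemma it is enough to
    treat the arithmetic means of the S_m, and these appear when cos (s t) is
    integrated over [0, pi] against the Fejer kernel. The mean value theorem,
    applied to an explicit primitive, bounds their distance to pi / sin (s pi)
    by O(1 / N) ([fejer_bound]). *)

(** * The Fejer kernel and the cosecant series *)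

(** Partial sums of the partial fraction expansion of pi / sin (s pi). *)
Definition csc_sum (R : realType) (s : R) (m : nat) : R :=
  s^-1 + \sum_(k < m)
    (-1) ^+ k.+1 * ((s + k.+1%:R)^-1 + (s - k.+1%:R)^-1).

(** In the usual normalization (with the factor 1/2) this is twice the
    Dirichlet kernel of order [m]. *)
Definition dirichlet (R : realType) (m : nat) (t : R) : R :=
  1 + 2 * \sum_(k < m) cos (k.+1%:R * t).

Lemma dirichletE (R : realType) m (t : R) :
  (1 - cos t) * dirichlet m t = cos (m%:R * t) - cos (m.+1%:R * t).
Proof.
rewrite /dirichlet; elim: m => [|m IHm].
  by rewrite big_ord0 mul0r cos0 mul1r mulr0 addr0 mulr1.
have -> : cos (m.+2%:R * t) = 2 * cos t * cos (m.+1%:R * t) - cos (m%:R * t).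
  have -> : m.+2%:R * t = m.+1%:R * t + t by rewrite -natr1 mulrDl mul1r.
  have -> : m%:R * t = m.+1%:R * t - t by rewrite -natr1 mulrDl mul1r addrK.
  rewrite cosD cosB; ring.
rewrite big_ord_recr /=; move: IHm; set S := \sum_(k < m) _ => IHm.
have -> : (1 - cos t) * (1 + 2 * (S + cos (m.+1%:R * t))) =
   (1 - cos t) * (1 + 2 * S) + 2 * (1 - cos t) * cos (m.+1%:R * t) by ring.
rewrite IHm; ring.
Qed.

(** [N] times the usual Fejer kernel of order [N]; the two lemmas [dirichletE]
    and [fejerE] are closed forms freed of the division by [1 - cos t], so that
    they also hold at the singular points. *)
Definition fejer (R : realType) (N : nat) (t : R) : R :=
  \sum_(m < N) dirichlet m t.

Lemma fejerE (R : realType) N (t : R) :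
  (1 - cos t) * fejer N t = 1 - cos (N%:R * t).
Proof.
rewrite /fejer mulr_sumr; under eq_bigr do rewrite dirichletE.
elim: N => [|N IHN]; first by rewrite big_ord0 mul0r cos0 subrr.
rewrite big_ord_recr /= IHN; ring.
Qed.

Lemma is_derive_sinM (R : realType) (c t : R) : c != 0 ->
  is_derive t 1 (fun t => sin (c * t) / c) (cos (c * t)).
Proof.
move=> c0.
rewrite (_ : (fun t => _) = c^-1 *: (@sin R \o (c *: id))); last first.
  by apply/funext => x; rewrite /= [RHS]mulrC.
apply: is_derive_eq.
have -> : c%:A = c :> R by exact: mulr1.
by rewrite -[_ *: _]/(_ * _) mulrCA mulVf// mulr1.
Qed.

Lemma pole_neq0 (R : realType) (s : R) (k : nat) : 0 < s < 1 ->
  s + k.+1%:R != 0 /\ s - k.+1%:R != 0.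
Proof.
move=> /andP[s0 s1]; have k1 : 1 <= k.+1%:R :> R by rewrite ler1n.
by split; [rewrite gt_eqF//; lra|rewrite lt_eqF//; lra].
Qed.

(** The primitive of [cos (s t) * dirichlet m t] that vanishes at 0. Each
    frequency [k] of the Dirichlet kernel splits into [s + k] and [s - k], and
    it is at [t = pi] that the fractions of [csc_sum] come out. *)
Definition cos_dirichlet_prim (R : realType) (s : R) (m : nat) (t : R) : R :=
  sin (s * t) / s + \sum_(k < m)
    (sin ((s + k.+1%:R) * t) / (s + k.+1%:R)
     + sin ((s - k.+1%:R) * t) / (s - k.+1%:R)).

Lemma cos_dirichlet_prim0 (R : realType) (s : R) m : cos_dirichlet_prim s m 0 = 0.
Proof.
rewrite /cos_dirichlet_prim mulr0 sin0 mul0r add0r big1 // => k _.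
by rewrite !mulr0 sin0 !mul0r addr0.
Qed.

Lemma sinM_npi (R : realType) (s : R) k :
  sin ((s + k%:R) * pi) = (-1) ^+ k * sin (s * pi).
Proof.
elim: k => [|k IHk]; first by rewrite addr0 expr0 mul1r.
by rewrite -natr1 addrA mulrDl mul1r sinDpi IHk exprS mulN1r mulNr.
Qed.

Lemma cos_dirichlet_prim_pi (R : realType) (s : R) m :
  cos_dirichlet_prim s m pi = sin (s * pi) * csc_sum s m.
Proof.
rewrite /cos_dirichlet_prim /csc_sum [RHS]mulrDr mulr_sumr; congr (_ + _).
apply: eq_bigr => k _.
have -> : sin ((s - k.+1%:R) * pi) = (-1) ^+ k.+1 * sin (s * pi).
  by rewrite -{2}(subrK k.+1%:R s) sinM_npi mulrA -exprMn mulrNN mulr1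
    expr1n mul1r.
rewrite sinM_npi; ring.
Qed.

Lemma is_derive_cos_dirichlet_prim (R : realType) (s t : R) m : 0 < s < 1 ->
  is_derive t 1 (cos_dirichlet_prim s m) (cos (s * t) * dirichlet m t).
Proof.
move=> s01.
rewrite (_ : cos_dirichlet_prim s m = (fun t => sin (s * t) / s) +
   \sum_(k < m) ((fun t => sin ((s + k.+1%:R) * t) / (s + k.+1%:R)) +
     (fun t => sin ((s - k.+1%:R) * t) / (s - k.+1%:R)))); last first.
  by apply/funext => x; rewrite /cos_dirichlet_prim fctE fct_sumE.
have dk (k : 'I_m) := @is_deriveD R R R _ _ t 1 _ _
  (is_derive_sinM t (pole_neq0 k s01).1) (is_derive_sinM t (pole_neq0 k s01).2).
have s0 : s != 0 by rewrite gt_eqF//; case/andP: s01.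
apply: is_derive_eq (is_deriveD (is_derive_sinM t s0) (is_derive_sum dk)) _.
rewrite /dirichlet mulrDr mulr1; congr (_ + _).
rewrite mulrA mulr_sumr; apply: eq_bigr => k _.
rewrite !mulrDl mulNr cosD cosB; ring.
Qed.

Lemma is_derive_sum_sin (R : realType) (t : R) m :
  is_derive t 1 (fun t => t + 2 * \sum_(k < m) sin (k.+1%:R * t) / k.+1%:R)
   (dirichlet m t).
Proof.
rewrite (_ : (fun t => _) = id + 2 *:
   \sum_(k < m) (fun t => sin (k.+1%:R * t) / k.+1%:R)); last first.
  by apply/funext => x; rewrite !fctE fct_sumE.
have dk (k : 'I_m) := @is_derive_sinM R k.+1%:R t (lt0r_neq0 (ltr0Sn R k)).
exact: is_derive_eq (is_deriveD (is_derive_id t 1) (is_deriveZ 2 (is_derive_sum dk))) _.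
Qed.

(** The Cesaro means of [csc_sum s] are close to pi / sin (s pi). The function
    (1 - cos (s t)) fejer N t has an explicit primitive, whose increment over
    [0, pi] is the quantity to be bounded. Its values lie between 0 and 2: the
    Fejer kernel is nonnegative, and [cos t <= cos (s t)] bounds the product by
    (1 - cos t) fejer N t = 1 - cos (N t). The mean value theorem thus replaces
    any integration. *)
Lemma fejer_bound (R : realType) (s : R) N : 0 < s < 1 ->
  0 <= N%:R * pi - sin (s * pi) * \sum_(m < N) csc_sum s m <= 2 * pi.
Proof.
move=> s01.
pose F (t : R) := \sum_(m < N) (t + 2 * \sum_(k < m) sin (k.+1%:R * t) / k.+1%:R
  - cos_dirichlet_prim s m t).
have dF (t : R) : is_derive t 1 F ((1 - cos (s * t)) * fejer N t).
  rewrite (_ : F = \sum_(m < N)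
      ((fun t => t + 2 * \sum_(k < m) sin (k.+1%:R * t) / k.+1%:R)
       - cos_dirichlet_prim s m)); last first.
    by apply/funext => x; rewrite /F fct_sumE.
  have dm (m : 'I_N) := is_deriveB (is_derive_sum_sin t m)
    (is_derive_cos_dirichlet_prim t m s01).
  apply: is_derive_eq (is_derive_sum dm) _.
  by rewrite /fejer mulr_sumr; apply: eq_bigr => m _; rewrite mulrBl mul1r.
have F0 : F 0 = 0.
  rewrite /F big1// => m _; rewrite cos_dirichlet_prim0 subr0 add0r big1 ?mulr0// => k _.
  by rewrite mulr0 sin0 mul0r.
have Fpi : F pi = N%:R * pi - sin (s * pi) * \sum_(m < N) csc_sum s m.
  rewrite /F mulr_sumr -[N in N%:R * _]card_ord -sum1_card natr_sum mulr_suml -sumrB.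
  apply: eq_bigr => m _; rewrite cos_dirichlet_prim_pi mul1r; congr (_ - _).
  rewrite big1 ?mulr0 ?addr0// => k _.
  by rewrite -[k.+1%:R]add0r sinM_npi mul0r sin0 mulr0 add0r mul0r.
have [c c0pi] : exists2 c, c \in `]0, pi[%R &
    F pi - F 0 = ((1 - cos (s * c)) * fejer N c) * (pi - 0).
  apply: (@MVT R F (fun c => (1 - cos (s * c)) * fejer N c) 0 pi).
  - exact: pi_gt0.
  - by apply: derivable_within_continuous => x _; have [] := dF x.
rewrite F0 subr0 Fpi subr0 => ->.
move: c0pi; rewrite in_itv/= => /andP[c0 cpi].
have cos1 : 0 < 1 - cos c.
  by rewrite subr_gt0 -[ltRHS]cos0 ltr_cos// in_itv/= ?lexx ?pi_ge0// !ltW.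
have fge0 : 0 <= fejer N c.
  by rewrite -(pmulr_rge0 _ cos1) fejerE subr_ge0 cos_le1.
case/andP: s01 => s0 s1.
rewrite mulr_ge0 ?pi_ge0 ?mulr_ge0 ?subr_ge0 ?cos_le1//=.
rewrite ler_wpM2r ?pi_ge0//.
(* the cosine decreases on [0, pi], so cos (s * c) dominates cos c *)
have : cos c <= cos (s * c).
  rewrite leNgt ltr_cos ?in_itv/= -?leNgt ?(ltW c0) ?(ltW cpi)//; nra.
move=> cc; apply: (@le_trans _ _ ((1 - cos c) * fejer N c)).
  by rewrite ler_wpM2r// lerD2l lerN2.
by rewrite fejerE; have := cos_geN1 (N%:R * c); lra.
Qed.

Section CosecantSeries.
Local Open Scope classical_set_scope.

Lemma cvg_harmonic_bound (R : realType) (u : nat -> R) (l K : R) :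
  (forall n, `|l - u n| <= K * harmonic n) -> u n @[n --> \oo] --> l.
Proof.
move=> ul; apply/cvgrPdist_le => e e0.
have : K * harmonic n @[n --> \oo] --> (0 : R).
  rewrite -[X in _ --> X](mulr0 K); apply: cvgM; first exact: cvg_cst.
  exact: cvg_harmonic.
move=> /cvgr_le/(_ e e0); apply: filterS => n.
by apply: le_trans; exact: ul.
Qed.

(** If the partial sums converge at all, Cesaro's lemma gives their means the
    same limit, and [fejer_bound] identifies it. The convergence comes from the
    integral that the partial sums approximate. *)
Lemma csc_sum_lim (R : realType) (s C K : R) : 0 < s < 1 ->
  (forall m, `|C - csc_sum s m| <= K * harmonic m) -> C = pi / sin (s * pi).
Proof.
move=> s01 CK.
have /cesaro Cmean := cvg_harmonic_bound CK.
have sin_gt0 : 0 < sin (s * pi).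
  by apply: sin_gt0_pi; rewrite mulr_gt0 ?pi_gt0//= ?gtr_pMl ?pi_gt0//; case/andP: s01.
suff mean_pi : sin (s * pi) * arithmetic_mean (csc_sum s) n @[n --> \oo] --> (pi : R).
  have : sin (s * pi) * C = pi.
    apply: (cvg_unique _ _ mean_pi) => //.
    by apply: cvgM => //; exact: cvg_cst.
  by move=> E; apply: (mulfI (lt0r_neq0 sin_gt0)); rewrite E mulrCA mulfV ?mulr1// gt_eqF.
apply: (@cvg_harmonic_bound _ _ _ (2 * pi)) => n.
have /andP[b1 b2] := fejer_bound n.+1 s01.
rewrite /arithmetic_mean /= /series /= big_mkord.
move: b1 b2; set S := \sum_(m < n.+1) _ => b1 b2.
have n0 : 0 < n.+1%:R :> R by [].
have -> : pi - sin (s * pi) * (n.+1%:R^-1 * S) =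
   (n.+1%:R * pi - sin (s * pi) * S) / n.+1%:R by field; rewrite addrC natr1.
by rewrite ger0_norm ?divr_ge0// ler_pM2r ?invr_gt0.
Qed.

End CosecantSeries.

(** * Taylor polynomials of the logarithm *)

Definition ln1p_taylor (R : realType) (m : nat) (y : R) : R :=
  \sum_(k < m) (-1) ^+ k * y ^+ k.+1 / k.+1%:R.

Lemma is_derive_ln1p_taylor (R : realType) m (y : R) : 0 < 1 + y ->
  is_derive y 1 (fun y => ln (1 + y) - ln1p_taylor m y) ((- y) ^+ m / (1 + y)).
Proof.
move=> y1.
rewrite (_ : (fun y => _) = (@ln R \o (cst 1 + id)) -
   \sum_(k < m) ((-1) ^+ k / k.+1%:R) *: ((id : R -> R) ^+ k.+1)); last first.
  apply/funext => x; rewrite /ln1p_taylor fctE /= -[(- _) x]/(- (_ x)) fct_sumE.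
  congr (_ - _); apply: eq_bigr => k _; rewrite mulrAC.
  by rewrite scalrfctE exprfctE.
have dl := is_derive1_ln y1.
apply: is_derive_eq.
rewrite (eq_bigr (fun i : 'I_m => (- y) ^+ i)) => [|i _]; last first.
  rewrite -![_ *: _]/(_ * _) mulr1 /= mulrA divfK ?pnatr_eq0//.
  by rewrite -exprMn mulN1r.
rewrite add0r mulr1; have := subrX1 (- y) m.
set S := \sum_(i < m) _ => SE.
apply: (mulfI (lt0r_neq0 y1)).
rewrite [RHS]mulrC divfK ?lt0r_neq0// mulrBr mulfV ?lt0r_neq0//.
move: SE; lra.
Qed.

(** The remainder has derivative (-y)^m / (1 + y), of absolute value at most
    y^m; compare with the primitive y^(m+1) / (m+1). The bound is uniform on the
    whole half-line, also beyond the disc of convergence. *)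
Lemma ln1p_taylor_bound (R : realType) m (y : R) : 0 <= y ->
  `|ln (1 + y) - ln1p_taylor m y| <= y ^+ m.+1 / m.+1%:R.
Proof.
move=> y0.
(* one monotonicity argument, run for both signs e = 1 and e = -1 *)
suff H (e : R) : `|e| = 1 ->
    e * (ln (1 + y) - ln1p_taylor m y) <= y ^+ m.+1 / m.+1%:R.
  by rewrite ler_norml lerNl -mulN1r H ?normrN1// -[leLHS]mul1r H// normr1.
move=> e1.
pose g := (m.+1%:R^-1 *: ((id : R -> R) ^+ m.+1)) -
  e *: (fun y => ln (1 + y) - ln1p_taylor m y).
have dg (t : R) : 0 <= t ->
    is_derive t 1 g (t ^+ m - e * ((- t) ^+ m / (1 + t))).
  move=> t0.
  have dt : is_derive t 1 _ _ := @is_derive_ln1p_taylor R m t (ltr_wpDr t0 ltr01).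
  apply: is_derive_eq.
  rewrite -[_ *: (1:R)]/(_ * (1:R)) mulr1 -[_ *: (_ * _)]/(_ * (_ * _)) mulrA.
  by rewrite mulVf ?mul1r ?pnatr_eq0.
have [c] : exists2 c, c \in `[0, y]%R & g y - g 0 =
     (c ^+ m - e * ((- c) ^+ m / (1 + c))) * (y - 0).
  apply: (@MVT_segment R g (fun c => c ^+ m - e * ((- c) ^+ m / (1 + c))) 0 y y0) => [x|].
    by rewrite in_itv/= => /andP[/ltW ? _]; exact: dg.
  apply: derivable_within_continuous => x.
  by rewrite in_itv/= => /andP[/dg[]].
rewrite in_itv/= => /andP[c0 _].
have g0 : g 0 = 0.
  rewrite /g !fctE /= expr0n /= addr0 ln1 /ln1p_taylor big1; last first.
    by move=> k _; rewrite expr0n/= mulr0 mul0r.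
  by rewrite subrr !scaler0 subrr.
rewrite g0 !subr0 => gE.
rewrite -subr_ge0 (_ : _ - _ = g y); last by rewrite /g !fctE mulrC.
rewrite gE mulr_ge0// subr_ge0.
apply: (le_trans (ler_norm _)).
rewrite !normrM e1 mul1r normrX normrN normfV (ger0_norm c0).
rewrite ger0_norm ?addr_ge0// ler_pdivrMr ?ltr_wpDr// ler_peMr ?exprn_ge0//.
by rewrite lerDl.
Qed.

(** * Integrals given by their value *)

(** Integrability and value are kept together: integrands are combined with
    signs below, and additivity of the integral needs both. *)
Definition has_int d (T : measurableType d) (R : realType)
    (mu : {measure set T -> \bar R}) (D : set T) (f : T -> R) (v : R) : Prop :=
  mu.-integrable D (EFin \o f) /\ (\int[mu]_(x in D) (f x)%:E = v%:E)%E.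

Section HasInt.
Local Open Scope classical_set_scope.
Context d (T : measurableType d) (R : realType).
Variable mu : {measure set T -> \bar R}.
Implicit Types (D : set T) (f g : T -> R) (u v : R).

Lemma eq_has_int D f g v : measurable D -> (forall x, D x -> f x = g x) ->
  has_int mu D f v -> has_int mu D g v.
Proof.
move=> mD fg [fi fv]; split.
  by apply: eq_integrable fi => // x /set_mem Dx /=; rewrite fg.
by rewrite -fv; apply: eq_integral => x /set_mem Dx; rewrite fg.
Qed.

Lemma has_int_ge0 D f v : measurable D -> measurable_fun D f ->
  (forall x, D x -> 0 <= f x) ->
  (\int[mu]_(x in D) (f x)%:E = v%:E)%E -> has_int mu D f v.
Proof.
move=> mD mf f0 fv; split => //; apply/integrableP; split.
  exact/measurable_EFinP.
under eq_integral => x /set_mem Dx.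
  rewrite /= ger0_norm ?f0//; over.
by rewrite fv ltry.
Qed.

Lemma has_int_integrable D f : measurable D ->
  mu.-integrable D (EFin \o f) -> exists v, has_int mu D f v.
Proof.
move=> mD fi; exists (fine (\int[mu]_(x in D) (f x)%:E)); split => //.
by rewrite fineK//; exact: integrable_fin_num fi.
Qed.

Lemma has_intD D f g u v : measurable D -> has_int mu D f u -> has_int mu D g v ->
  has_int mu D (fun x => f x + g x) (u + v).
Proof.
move=> mD [fi fu] [gi gv]; split.
  by have := integrableD mD fi gi; apply: eq_integrable.
rewrite EFinD -fu -gv -integralD//.
Qed.

Lemma has_intZ D f c u : measurable D -> has_int mu D f u ->
  has_int mu D (fun x => c * f x) (c * u).
Proof.
move=> mD [fi fu]; split.
  by have := integrableZl mD c fi; apply: eq_integrable.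
by rewrite EFinM -fu -integralZl.
Qed.

Lemma has_intB D f g u v : measurable D -> has_int mu D f u -> has_int mu D g v ->
  has_int mu D (fun x => f x - g x) (u - v).
Proof.
move=> mD fu gv; rewrite -[in u - v]mulN1r.
apply: eq_has_int mD _ (has_intD mD fu (has_intZ (-1) mD gv)) => x _.
by rewrite mulN1r.
Qed.

Lemma has_int0 D : measurable D -> has_int mu D (fun=> 0) 0.
Proof.
by move=> mD; split; [exact: integrable0|rewrite integral0].
Qed.

Lemma has_int_sum (I : Type) (r : seq I) D (f : I -> T -> R) (v : I -> R) :
  measurable D -> (forall i, has_int mu D (f i) (v i)) ->
  has_int mu D (fun x => \sum_(i <- r) f i x) (\sum_(i <- r) v i).
Proof.
move=> mD fv; elim: r => [|i r IHr].
  rewrite big_nil; apply: eq_has_int mD _ (has_int0 mD) => x _.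
  by rewrite big_nil.
rewrite big_cons; apply: eq_has_int mD _ (has_intD mD (fv i) IHr) => x _.
by rewrite big_cons.
Qed.

Lemma has_int_le D f g u v : measurable D -> (forall x, D x -> f x <= g x) ->
  has_int mu D f u -> has_int mu D g v -> u <= v.
Proof.
move=> mD fg [fi fu] [gi gv]; rewrite -lee_fin -fu -gv.
by apply: le_integral => // x /set_mem Dx; rewrite lee_fin fg.
Qed.

Lemma has_intU_ge0 (A B : set T) f u v :
  measurable A -> measurable B -> [disjoint A & B] ->
  (forall x, (A `|` B) x -> 0 <= f x) ->
  has_int mu A f u -> has_int mu B f v -> has_int mu (A `|` B) f (u + v).
Proof.
move=> mA mB AB f0 [/measurable_int/measurable_EFinP mfA fu].
move=> [/measurable_int/measurable_EFinP mfB fv].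
have mf : measurable_fun (A `|` B) f by apply/measurable_funU.
apply: has_int_ge0 => //; first exact: measurableU.
rewrite ge0_integral_setU// ?fu ?fv//.
exact/measurable_EFinP.
Qed.

End HasInt.

Section HasIntLebesgue.
Local Open Scope classical_set_scope.
Context {R : realType}.
Implicit Types (f F : R -> R).
Notation mu := (@lebesgue_measure R).

(** The fundamental theorem of calculus on an interval whose left end is
    singular, by exhaustion from the compact intervals [a / (n + 2), a]. *)
Lemma has_int_itv_oc f F (a : R) : 0 < a ->
  (forall z : R, 0 < z -> is_derive z 1 F (f z)) ->
  (forall z : R, 0 < z -> {for z, continuous f}) ->
  (forall z : R, 0 < z <= a -> 0 <= f z) ->
  F z @[z --> 0^'+] --> 0 -> has_int mu `]0, a] f (F a).
Proof.
move=> a0 dF cf f0 F0.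
have mf : measurable_fun (`]0, +oo[ : set R) f.
  apply: open_continuous_measurable_fun => // x.
  by rewrite inE/= in_itv/= andbT => /cf.
have mfa : measurable_fun (`]0, a] : set R) f.
  by apply: measurable_funS mf => //; apply: subset_itvl.
apply: has_int_ge0 => //.
(* n + 2 rather than n + 1, so that no interval is reduced to a point *)
pose e (n : nat) : R := a / n.+2%:R.
have e0 n : 0 < e n by rewrite divr_gt0.
have ea n : e n < a by rewrite ltr_pdivrMr// ltr_pMr// ltr1n.
have cvg_e : e @ \oo --> 0.
  rewrite -[0](mulr0 a); apply: cvgM; first exact: cvg_cst.
  by rewrite (cvg_shiftS (@harmonic R)); exact: cvg_harmonic.
have itvE : `]0, a]%classic = \bigcup_n `[e n, a]%classic.
  apply/seteqP; split => x /=; rewrite in_itv/=.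
    move=> /andP[x0 xa].
    have /cvgr_lt/(_ x x0) [n _ /(_ n (leqnn n))/= enx] := cvg_e.
    by exists n => //=; rewrite in_itv/= xa ltW.
  by move=> [n _] /=; rewrite in_itv/= => /andP[enx ->]; rewrite (lt_le_trans _ enx).
have mfn n : measurable_fun (`[e n, a] : set R) f.
  apply: measurable_funS mf => // x /=; rewrite !in_itv/= andbT => /andP[+ _].
  exact: lt_le_trans.
have : (\int[mu]_(x in `[e i, a]) (f x)%:E)%E @[i --> \oo] -->
    (\int[mu]_(x in \bigcup_n `[e n, a]%classic) (f x)%:E)%E.
  apply: ge0_nondecreasing_set_cvg_integral => //.
  - move=> m n mn; rewrite subsetEset => x /=; rewrite !in_itv/= => /andP[mx ->].
    rewrite andbT (le_trans _ mx)// ler_pM2l//.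
    by rewrite lef_pV2 ?posrE// ler_nat !ltnS.
  - by move=> n; apply/measurable_EFinP; exact: mfn.
  - move=> n x /=; rewrite in_itv/= => /andP[ex xa].
    by rewrite lee_fin f0// xa (lt_le_trans _ ex).
rewrite -itvE => cvgI.
have IE n : (\int[mu]_(x in `[e n, a]) (f x)%:E = (F a - F (e n))%:E)%E.
  have cF z : 0 < z -> {for z, continuous F}.
    move=> /dF[dz _]; apply/differentiable_continuous; exact/derivable1_diffP.
  rewrite (@continuous_FTC2 _ f F)//.
  - apply: continuous_in_subspaceT => x; rewrite inE/= in_itv/= => /andP[ex _].
    by apply: cf; rewrite (lt_le_trans _ ex).
  - split.
    + by move=> x; rewrite in_itv/= => /andP[ex _];
        have [] := dF x (lt_trans (e0 n) ex).
    + by apply: cvg_at_right_filter; exact: cF.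
    + by apply: cvg_at_left_filter; exact: cF.
  - move=> x; rewrite in_itv/= => /andP[ex _].
    by rewrite derive1E; have [] := dF x (lt_trans (e0 n) ex).
move: cvgI; under eq_fun do rewrite IE.
have : (F a - F (e n))%:E @[n --> \oo] --> (F a)%:E.
  apply: cvg_EFin; first exact: nearW.
  rewrite -[X in _ --> X]subr0; apply: cvgB; first exact: cvg_cst.
  by have /cvg_at_rightP := F0; apply; split.
move=> c1 c2; exact: (cvg_unique _ c2 c1).
Qed.

Lemma has_int_itv_cy f F (a : R) :
  (forall z : R, a <= z -> is_derive z 1 F (f z)) ->
  (forall z : R, a <= z -> {for z, continuous f}) ->
  (forall z : R, a <= z -> 0 <= f z) ->
  F z @[z --> +oo] --> 0 -> has_int mu `[a, +oo[ f (- F a).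
Proof.
move=> dF cf f0 Fy.
have cfa : {within `[a, +oo[, continuous f}.
  apply: continuous_in_subspaceT => x; rewrite inE/= in_itv/= andbT.
  exact: cf.
apply: has_int_ge0 => //.
- exact: subspace_continuous_measurable_fun.
- by move=> x /=; rewrite in_itv/= andbT => /f0.
rewrite (@ge0_continuous_FTC2y _ f F a 0)//.
- by rewrite sub0e.
- by move=> x /ltW /dF[].
- apply: cvg_at_right_filter; apply/differentiable_continuous/derivable1_diffP.
  by have [] := dF a (lexx a).
- move=> x; rewrite in_itv/= andbT => /ltW ax.
  by rewrite derive1E; have [] := dF x ax.
Qed.

End HasIntLebesgue.

(** * Integrals of powers and of logarithmic series *)

(** Integration of a logarithmic series term by term, with an error bound in
    place of convergence: integrating [ln1p_taylor_bound] against the weight [w]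
    compares the integral with its [m]-th partial sum. The case [m = 0] is the
    domination [ln (1 + y) <= y], which gives integrability. *)
Lemma has_int_ln1p d (T : measurableType d) (R : realType)
    (mu : {measure set T -> \bar R}) (D : set T) (w y : T -> R) (c : nat -> R) :
  measurable D -> measurable_fun D (fun x => w x * ln (1 + y x)) ->
  (forall x, D x -> 0 <= w x) -> (forall x, D x -> 0 <= y x) ->
  (forall k, has_int mu D (fun x => w x * y x ^+ k.+1) (c k)) ->
  exists2 J, has_int mu D (fun x => w x * ln (1 + y x)) J &
    forall m, `|J - \sum_(k < m) (-1) ^+ k / k.+1%:R * c k| <= c m / m.+1%:R.
Proof.
move=> mD mf w0 y0 cE.
have taylorE m (x : T) : \sum_(k < m) (-1) ^+ k / k.+1%:R * (w x * y x ^+ k.+1)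
    = w x * ln1p_taylor m (y x).
  rewrite /ln1p_taylor mulr_sumr; apply: eq_bigr => k _; ring.
have bound m x : D x -> `|w x * ln (1 + y x) - w x * ln1p_taylor m (y x)|
    <= m.+1%:R^-1 * (w x * y x ^+ m.+1).
  move=> Dx; rewrite -mulrBr normrM (ger0_norm (w0 _ Dx)) mulrCA.
  by rewrite ler_wpM2l ?w0// mulrC ln1p_taylor_bound ?y0.
have fi : mu.-integrable D (EFin \o (fun x => w x * ln (1 + y x))).
  have [wyi _] := cE 0%N.
  apply: (le_integrable mD _ _ wyi); first exact/measurable_EFinP.
  move=> x Dx /=; rewrite lee_fin.
  have := bound 0%N x Dx; rewrite -taylorE big_ord0 subr0 invr1 mul1r.
  by move=> /le_trans; apply; exact: ler_norm.
have [J fJ] := has_int_integrable mD fi.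
exists J => // m.
have dJ := has_intB mD fJ (has_int_sum (index_enum 'I_m) mD
  (fun k : 'I_m => has_intZ ((-1) ^+ k / k.+1%:R) mD (cE k))).
have eJ := has_intZ m.+1%:R^-1 mD (cE m).
rewrite [leRHS]mulrC ler_norml; apply/andP; split.
  rewrite -[leLHS]mulN1r; apply: (has_int_le mD _ (has_intZ (-1) mD eJ) dJ) => x Dx.
  by rewrite mulN1r taylorE; have := bound m x Dx; rewrite ler_norml => /andP[].
apply: (has_int_le mD _ dJ eJ) => x Dx.
by rewrite taylorE; have := bound m x Dx; rewrite ler_norml => /andP[].
Qed.

Section PowerIntegrals.
Local Open Scope classical_set_scope.
Context {R : realType}.
Implicit Types (p q a z : R).
Notation mu := (@lebesgue_measure R).

Lemma continuous_powR q z : 0 < z -> {for z, continuous (@powR R ^~ q)}.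
Proof.
move=> z0; apply/differentiable_continuous/derivable1_diffP.
by have [] := is_derive1_powR q z0.
Qed.

Lemma powR_cvgy0 q : 0 < q -> z `^ (- q) @[z --> +oo] --> 0.
Proof.
move=> q0; apply/cvgr0Pnorm_lt => e e0; near=> z.
have ez : e `^ (- q^-1) < z by near: z; exact: nbhs_pinfty_gt.
have z0 : 0 < z by apply: le_lt_trans ez; exact: powR_ge0.
rewrite ger0_norm ?powR_ge0// powRN invf_plt ?posrE ?powR_gt0//.
have : (e `^ (- q^-1)) `^ q < z `^ q.
  by apply: gt0_ltr_powR => //; rewrite nnegrE ?powR_ge0// ltW.
by rewrite -powRrM mulNr mulVf ?gt_eqF// powR_inv1// ltW.
Unshelve. all: by end_near. Qed.

(** Half of the power beats the logarithm: [ln x < x] at [x = z `^ (- (q / 2))]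
    bounds |ln z| by (2 / q) z^(- q / 2). *)
Lemma powR_ln_cvg0 q : 0 < q -> z `^ q * ln z @[z --> 0^'+] --> 0.
Proof.
move=> q0.
pose h z := - (2 / q) * z `^ (q / 2).
have hcvg : h z @[z --> 0^'+] --> 0.
  rewrite -[X in _ --> X](mulr0 (- (2 / q))).
  by apply: cvgM; [exact: cvg_cst|apply: powR_cvg0; rewrite divr_gt0].
apply: (squeeze_cvgr _ hcvg (cvg_cst 0)).
near=> z.
have z0 : 0 < z by [].
have z1 : z <= 1 by near: z; exact: nbhs_right_le.
rewrite mulr_ge0_le0 ?powR_ge0 ?ln_le0// andbT.
have := ln_sublinear (powR_gt0 (- (q / 2)) z0).
rewrite ln_powR powRN => H.
have -> : z `^ q = z `^ (q / 2) * z `^ (q / 2).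
  by rewrite -powRD ?(gt_eqF z0) ?implybT//; congr (_ `^ _); field.
rewrite /h; set P := z `^ (q / 2) in H *.
have P0 : 0 < P by exact: powR_gt0.
rewrite mulrC -mulrA ler_pM2l//.
have -> : - (2 / q) = (q / 2)^-1 * (P * - P^-1).
  by rewrite mulrN mulfV ?gt_eqF// invf_div mulrN1.
have -> : P * ln z = (q / 2)^-1 * (P * - (- (q / 2) * ln z)).
  by field; rewrite gt_eqF.
rewrite ler_pM2l ?invr_gt0 ?divr_gt0// ler_pM2l// lerN2.
exact: ltW.
Unshelve. all: by end_near. Qed.

Lemma has_int_powR_oc q a : 0 < q -> 0 < a ->
  has_int mu `]0, a] (fun z => z `^ (q - 1)) (a `^ q / q).
Proof.
move=> q0 a0.
apply: (@has_int_itv_oc R _ (fun z => z `^ q / q)) => //.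
- move=> z z0; rewrite (_ : (fun z => _) = q^-1 *: (@powR R ^~ q)); last first.
    by apply/funext => x; rewrite mulrC.
  apply: is_derive_eq (is_deriveZ q^-1 (is_derive1_powR q z0)) _.
  by rewrite -[_ *: _]/(_ * _) mulKf ?gt_eqF.
- by move=> z z0; exact: continuous_powR.
- by move=> z _; exact: powR_ge0.
- rewrite -[X in _ --> X](mul0r q^-1).
  by apply: cvgM; [exact: powR_cvg0|exact: cvg_cst].
Qed.

Lemma has_int_powR_cy q a : 0 < q -> 0 < a ->
  has_int mu `[a, +oo[ (fun z => z `^ (- q - 1)) (a `^ (- q) / q).
Proof.
move=> q0 a0.
have -> : a `^ (- q) / q = - (a `^ (- q) / (- q)) by rewrite invrN mulrN opprK.
apply: (@has_int_itv_cy R _ (fun z => z `^ (- q) / (- q))).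
- move=> z az; have z0 := lt_le_trans a0 az.
  rewrite (_ : (fun z => _) = (- q)^-1 *: (@powR R ^~ (- q))); last first.
    by apply/funext => x; rewrite mulrC.
  apply: is_derive_eq (is_deriveZ (- q)^-1 (is_derive1_powR (- q) z0)) _.
  by rewrite -[_ *: _]/(_ * _) mulKf// oppr_eq0 gt_eqF.
- by move=> z az; apply: continuous_powR; exact: lt_le_trans az.
- by move=> z _; exact: powR_ge0.
- rewrite -[X in _ --> X](mul0r (- q)^-1).
  by apply: cvgM; [exact: powR_cvgy0|exact: cvg_cst].
Qed.

Lemma has_int_powR_ln q a : 0 < q -> 0 < a ->
  has_int mu `]0, a] (fun z => z `^ (q - 1) * ln (a / z)) (a `^ q / q ^+ 2).
Proof.
move=> q0 a0.
suff H : has_int mu `]0, a] (fun z => z `^ (q - 1) * (ln a - ln z))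
    (a `^ q / q ^+ 2).
  apply: eq_has_int _ _ H => // z /=; rewrite in_itv/= => /andP[z0 _].
  by rewrite ln_div// posrE.
pose F z := q^-1 * (z `^ q * (ln a - ln z)) + z `^ q / q ^+ 2.
have -> : a `^ q / q ^+ 2 = F a by rewrite /F subrr !mulr0 add0r.
apply: has_int_itv_oc => //.
- move=> z z0; rewrite (_ : F = q^-1 *: ((@powR R ^~ q) * (cst (ln a) - @ln R))
      + (q ^+ 2)^-1 *: (@powR R ^~ q)); last first.
    by apply/funext => x; rewrite /F [_ / q ^+ 2]mulrC.
  have dp := is_derive1_powR q z0.
  have dl := is_deriveB (is_derive_cst (ln a) z 1) (is_derive1_ln z0).
  apply: is_derive_eq (is_deriveD (is_deriveZ q^-1 (is_deriveM dp dl))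
    (is_deriveZ (q ^+ 2)^-1 dp)) _.
  rewrite -![_ *: _]/(_ * _) sub0r /= -[(cst _ - _) z]/(ln a - ln z).
  have -> : z `^ q = z * z `^ (q - 1) by rewrite mulr_powRB1// ltW.
  by field; rewrite !gt_eqF.
- move=> z z0; apply: cvgM; first exact: continuous_powR.
  by apply: cvgB; [exact: cvg_cst|exact: continuous_ln].
- move=> z /andP[z0 za]; rewrite mulr_ge0 ?powR_ge0// subr_ge0 ler_ln//.
- suff : F z @[z --> 0^'+] --> q^-1 * (0 * ln a - 0) + 0 / q ^+ 2.
    by rewrite !mul0r subrr mulr0 addr0.
  have cp : z `^ q @[z --> 0^'+] --> 0 by exact: powR_cvg0.
  apply: cvgD; last by apply: cvgM => //; exact: cvg_cst.
  apply: cvgM; first exact: cvg_cst.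
  under eq_fun do rewrite mulrBr.
  apply: cvgB; last exact: powR_ln_cvg0.
  by apply: cvgM => //; exact: cvg_cst.
Qed.

End PowerIntegrals.

(** * The integral attached to one eigenvalue *)

Section EnergyKernel.
Local Open Scope classical_set_scope.
Context {R : realType}.
Implicit Types (p a z : R).
Notation mu := (@lebesgue_measure R).

Lemma has_int_itv_oy (f : R -> R) (a u v : R) : 0 < a ->
  (forall z, 0 < z -> 0 <= f z) ->
  has_int mu `]0, a] f u ->
  has_int mu `[a, +oo[ f v ->
  has_int mu `]0, +oo[ f (u + v).
Proof.
move=> a0 f0 fu [fi fv].
have fv' : has_int mu `]a, +oo[ f v.
  have sub : (`]a, +oo[ : set R) `<=` `[a, +oo[.
    by apply: subset_itvr; rewrite bnd_simp.
  have fi' : mu.-integrable `]a, +oo[ (EFin \o f).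
    by apply: integrableS fi.
  split => //.
  rewrite -fv integral_itv_obnd_cbnd//.
  exact: measurable_int fi'.
have -> : (`]0, +oo[ : set R) = `]0, a] `|` `]a, +oo[.
  apply/seteqP; split => z /=; rewrite !in_itv/= !andbT.
    by move=> z0; case: (leP z a) => za; [left; rewrite z0|right].
  by move=> [/andP[]//|]; exact: lt_trans.
apply: has_intU_ge0 => //.
  apply/disj_setPS => z [] /=; rewrite !in_itv/= andbT => /andP[_ za].
  by rewrite ltNge za.
move=> z [] /=; rewrite in_itv/= => /andP[z0 _]; apply: f0 => //.
exact: lt_trans z0.
Qed.

(** The contribution of an eigenvalue of absolute value [a]: dividing
    z^2 + a^2 by z^2 makes each term integrable by itself, and the factors z^2
    cancel between two graphs with the same number of vertices. *)
Definition energy_kernel p a z : R := z `^ (p - 1) * ln (1 + (a / z) ^+ 2).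

Lemma measurable_powR_ln1p p (D : set R) (y : R -> R) :
  measurable D -> D `<=` `]0, +oo[ -> (forall z, 0 < z -> {for z, continuous y}) ->
  (forall z, 0 < z -> 0 <= y z) ->
  measurable_fun D (fun z => z `^ (p - 1) * ln (1 + y z)).
Proof.
move=> mD D0 cy y0.
apply: (@measurable_funS _ _ _ _ (`]0, +oo[ : set R)) => //.
apply: open_continuous_measurable_fun => // z.
rewrite inE/= in_itv/= andbT => z0; apply: cvgM; first exact: continuous_powR.
apply: continuous_comp; last by apply: continuous_ln; rewrite ltr_wpDr ?y0.
by apply: cvgD; [exact: cvg_cst|exact: cy].
Qed.

(** Powers of a / z times z^(p-1) are not integrable at 0, so a / z is first
    extracted from the logarithm, and the series is applied to what remains:
    ln (1 + (a / z)^2) = 2 ln (a / z) + ln (1 + (z / a)^2). *)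
Lemma energy_kernel_near0 p a : 0 < p -> 0 < a ->
  exists2 J, has_int mu `]0, a] (energy_kernel p a) J &
  forall m, `|J - (2 * (a `^ p / p ^+ 2) +
    \sum_(k < m) (-1) ^+ k / k.+1%:R * (a `^ p / (p + 2 * k.+1%:R)))|
   <= a `^ p / (p + 2 * m.+1%:R) / m.+1%:R.
Proof.
move=> p0 a0; have an0 : a != 0 by rewrite gt_eqF.
have itv0 : (`]0, a] : set R) `<=` `]0, +oo[ by exact: subset_itvl.
have cy z : 0 < z -> {for z, continuous (fun z => (z / a) ^+ 2)}.
  move=> z0; apply: (@continuous_comp _ _ _ (fun z => z / a) (fun z => z ^+ 2)).
    by apply: cvgM; [exact: cvg_id|exact: cvg_cst].
  exact: exprn_continuous.
have cE k : has_int mu `]0, a] (fun z => z `^ (p - 1) * ((z / a) ^+ 2) ^+ k.+1)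
    (a `^ p / (p + 2 * k.+1%:R)).
  have q0 : 0 < p + 2 * k.+1%:R by rewrite addr_gt0 ?mulr_gt0.
  have -> : a `^ p / (p + 2 * k.+1%:R) = a ^- (2 * k.+1) *
      (a `^ (p + 2 * k.+1%:R) / (p + 2 * k.+1%:R)).
    rewrite powRD ?an0 ?implybT// -natrM powR_mulrn ?(ltW a0)//.
    rewrite -mulrA [RHS]mulrCA; congr (_ * _).
    by rewrite mulrA mulVf ?mul1r// expf_neq0.
  apply: eq_has_int _ _ (has_intZ (a ^- (2 * k.+1)) _ (has_int_powR_oc q0 a0)) => //.
  move=> z /=; rewrite in_itv/= => /andP[z0 _].
  have -> : p + 2 * k.+1%:R - 1 = (p - 1) + (2 * k.+1)%:R by rewrite natrM; ring.
  rewrite powRD ?(gt_eqF z0) ?implybT// powR_mulrn ?(ltW z0)//.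
  by rewrite -exprM expr_div_n mulrC mulrA.
have [|||z _|J HJ JE] := has_int_ln1p _ _ _ _ cE.
- by [].
- by apply: measurable_powR_ln1p => // z _; exact: sqr_ge0.
- by move=> z _; exact: powR_ge0.
- exact: sqr_ge0.
exists (2 * (a `^ p / p ^+ 2) + J); last first.
  by move=> m; rewrite opprD addrACA subrr add0r; exact: JE.
apply: eq_has_int _ _ (has_intD _ (has_intZ 2 _ (has_int_powR_ln p0 a0)) HJ) => //.
move=> z /=; rewrite in_itv/= => /andP[z0 _].
rewrite /energy_kernel mulrCA -mulrDr; congr (_ * _).
have az : 0 < a / z by rewrite divr_gt0.
rewrite mulr_natl -lnXn// -lnM ?posrE ?exprn_gt0//; last first.
  by rewrite ltr_wpDr ?sqr_ge0.
by congr ln; field; rewrite an0 gt_eqF.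
Qed.

(** Here the series applies directly. Its first term a^2 z^(p-3) is integrable
    at infinity because p < 2, and it dominates the kernel. *)
Lemma energy_kernel_neary p a : 0 < p < 2 -> 0 < a ->
  exists2 J, has_int mu `[a, +oo[ (energy_kernel p a) J &
  forall m, `|J - \sum_(k < m) (-1) ^+ k / k.+1%:R * (a `^ p / (2 * k.+1%:R - p))|
   <= a `^ p / (2 * m.+1%:R - p) / m.+1%:R.
Proof.
move=> /andP[p0 p2] a0; have an0 : a != 0 by rewrite gt_eqF.
have itv0 : (`[a, +oo[ : set R) `<=` `]0, +oo[.
  by apply: subset_itvr; rewrite bnd_simp.
have cy z : 0 < z -> {for z, continuous (fun z => (a / z) ^+ 2)}.
  move=> z0; apply: (@continuous_comp _ _ _ (fun z => a / z) (fun z => z ^+ 2)).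
    apply: cvgM; first exact: cvg_cst.
    by apply: cvgV; [rewrite gt_eqF|exact: cvg_id].
  exact: exprn_continuous.
have cE k : has_int mu `[a, +oo[ (fun z => z `^ (p - 1) * ((a / z) ^+ 2) ^+ k.+1)
    (a `^ p / (2 * k.+1%:R - p)).
  have q0 : 0 < 2 * k.+1%:R - p.
    by have : 1 <= k.+1%:R :> R by [rewrite ler1n]; lra.
  have -> : a `^ p / (2 * k.+1%:R - p) = a ^+ (2 * k.+1) *
      (a `^ (- (2 * k.+1%:R - p)) / (2 * k.+1%:R - p)).
    rewrite opprB powRB ?an0 ?implybT// -natrM powR_mulrn ?(ltW a0)//.
    by rewrite [RHS]mulrA [X in _ = X / _]mulrCA mulfV ?mulr1// expf_neq0.
  apply: eq_has_int _ _ (has_intZ (a ^+ (2 * k.+1)) _ (has_int_powR_cy q0 a0)) => //.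
  move=> z /=; rewrite in_itv/= andbT => az; have z0 := lt_le_trans a0 az.
  have -> : - (2 * k.+1%:R - p) - 1 = (p - 1) - (2 * k.+1)%:R by rewrite natrM; ring.
  rewrite powRB ?(gt_eqF z0) ?implybT// powR_mulrn ?(ltW z0)//.
  by rewrite -exprM expr_div_n mulrCA.
apply: (has_int_ln1p _ _ _ _ cE).
- by [].
- by apply: measurable_powR_ln1p => // z _; exact: sqr_ge0.
- by move=> z _; exact: powR_ge0.
- by move=> z _; exact: sqr_ge0.
Qed.

(** The left-hand side collects the constants produced by the two halves of the
    integral of the kernel; K^-1 ((p + 2K)^-1 + (2K - p)^-1) equals
    4 / (4 K^2 - p^2), the general term of the cosecant expansion at p / 2. *)
Lemma csc_sum_half p m : 0 < p < 2 ->
  2 / p ^+ 2 + \sum_(k < m) (-1) ^+ k / k.+1%:R *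
    ((p + 2 * k.+1%:R)^-1 + (2 * k.+1%:R - p)^-1) = csc_sum (p / 2) m / p.
Proof.
move=> p02; have /andP[p0 p2] := p02.
have pn0 : p != 0 by rewrite gt_eqF.
rewrite /csc_sum [RHS]mulrDl mulr_suml; congr (_ + _); first by field.
apply: eq_bigr => k _.
have k1 : 1 <= k.+1%:R :> R by rewrite ler1n.
rewrite exprS mulN1r -!mulrA mulNr -mulrN; congr (_ * _).
move: k1; move: (k.+1%:R) => K K1; field.
rewrite pn0 andTb.
by apply/and4P; split; (rewrite gt_eqF//; lra) || (rewrite lt_eqF//; lra).
Qed.

(** The two halves show that the integral, divided by a^p, is the limit of
    csc_sum (p / 2) m / p, with an error O(1 / m). *)
Lemma has_int_energy_kernel p a : 0 < p < 2 -> 0 < a ->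
  has_int mu `]0, +oo[ (energy_kernel p a) (a `^ p * (pi / (p * sin (p * pi / 2)))).
Proof.
move=> p02 a0; have /andP[p0 p2] := p02.
have [J0 H0 B0] := energy_kernel_near0 p0 a0.
have [Jy Hy By] := energy_kernel_neary p02 a0.
have k_ge0 z : 0 < z -> 0 <= energy_kernel p a z.
  by move=> _; rewrite mulr_ge0 ?powR_ge0// ln_ge0// lerDl sqr_ge0.
have H := has_int_itv_oy a0 k_ge0 H0 Hy.
have pn0 : p != 0 by rewrite gt_eqF.
have ap0 : 0 < a `^ p by exact: powR_gt0.
suff -> : pi / (p * sin (p * pi / 2)) = (J0 + Jy) / a `^ p.
  by rewrite mulrC divfK ?gt_eqF.
suff : p * ((J0 + Jy) / a `^ p) = pi / sin (p / 2 * pi).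
  move=> E; apply: (mulfI pn0).
  by rewrite E [p / 2 * pi]mulrAC invfM mulrCA mulVKf.
apply: (@csc_sum_lim _ _ _ (p * (2^-1 + (2 - p)^-1))); first lra.
move=> m.
have -> : csc_sum (p / 2) m = p * (csc_sum (p / 2) m / p).
  by rewrite mulrCA mulfV ?mulr1.
rewrite -csc_sum_half// -mulrBr normrM gtr0_norm// -mulrA ler_pM2l//.
set S := _ + \sum_(k < m) _.
have -> : (J0 + Jy) / a `^ p - S = (a `^ p)^-1 *
    ((J0 - (2 * (a `^ p / p ^+ 2) +
      \sum_(k < m) (-1) ^+ k / k.+1%:R * (a `^ p / (p + 2 * k.+1%:R)))) +
    (Jy - \sum_(k < m) (-1) ^+ k / k.+1%:R * (a `^ p / (2 * k.+1%:R - p)))).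
  have -> : S = (a `^ p)^-1 * (2 * (a `^ p / p ^+ 2) +
      \sum_(k < m) (-1) ^+ k / k.+1%:R * (a `^ p / (p + 2 * k.+1%:R)) +
      \sum_(k < m) (-1) ^+ k / k.+1%:R * (a `^ p / (2 * k.+1%:R - p))).
    rewrite -addrA -big_split mulrDr; congr (_ + _).
      by rewrite mulrCA mulrA -mulrA mulKf ?gt_eqF.
    rewrite mulr_sumr; apply: eq_bigr => k _ /=.
    by rewrite -mulrDr -mulrDr mulrCA mulKf ?gt_eqF.
  ring.
rewrite normrM gtr0_norm ?invr_gt0// ler_pdivrMl//.
apply: (le_trans (ler_normD _ _)); apply: (le_trans (lerD (B0 m) (By m))).
rewrite -!mulrA -mulrDr ler_pM2l// /harmonic /= -mulrDl ler_pM2r ?invr_gt0//.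
have m1 : 1 <= m.+1%:R :> R by rewrite ler1n.
by apply: lerD; rewrite lef_pV2 ?posrE; lra.
Qed.

End EnergyKernel.

(** * The characteristic polynomial of a bipartite graph on the imaginary axis *)

(** Over a family symmetric about 0, a product only depends on the value at 0
    and on the products over opposite pairs. *)
Lemma big_opp_closed (R : realDomainType) (S : comNzRingType) (s : seq R)
    (F H : R -> S) :
  perm_eq s [seq - l | l <- s] -> F 0 = H 0 ->
  (forall l, 0 < l -> F l * F (- l) = H l * H (- l)) ->
  \prod_(l <- s) F l = \prod_(l <- s) H l.
Proof.
move=> sN F0 FH.
have split3 (E : R -> S) : \prod_(l <- s) E l =
    \prod_(l <- s | 0 < l) (E l * E (- l)) * \prod_(l <- s | l == 0) E 0.
  have -> : \prod_(l <- s | 0 < l) (E l * E (- l)) =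
      \prod_(l <- s | 0 < l) E l * \prod_(l <- s | l < 0) E l.
    rewrite big_split; congr (_ * _); rewrite [RHS](perm_big _ sN) big_map.
    by apply: eq_bigl => l; rewrite oppr_lt0.
  rewrite (bigID (fun l => 0 < l)) -mulrA; congr (_ * _).
  rewrite (bigID (fun l => l < 0)); congr (_ * _).
    by apply: eq_bigl => l; case: ltgtP.
  transitivity (\prod_(l <- s | l == 0) E l).
    by apply: eq_bigl => l; case: ltgtP.
  by apply: eq_bigr => l /eqP ->.
rewrite !split3 F0; congr (_ * _); apply: eq_bigr => l; exact: FH.
Qed.

Section Spectrum.
Context {R : realType} {V : finType} (G : sgraph V).

Lemma size_eigenvalues : size (eigenvalues R G) = #|V|.
Proof.
have := size_char_poly (adjmx R G); rewrite char_poly_eigenvalues.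
by rewrite size_prod_XsubC => -[].
Qed.

(** Conjugating by the diagonal matrix D of signs that tell the two parts apart
    changes the adjacency matrix into its opposite, hence [char_poly] at -X
    agrees with [char_poly] up to the sign (-1)^|V|. *)
Lemma eigenvalues_opp : bipartite G ->
  perm_eq (eigenvalues R G) [seq - l | l <- eigenvalues R G].
Proof.
move=> [A bip]; set s := eigenvalues R G; set M := adjmx R G.
apply: prod_XsubC_eq; rewrite big_map -char_poly_eigenvalues -/M.
have mN : \prod_(l <- s) ('X - (- l)%:P) = (-1) ^+ #|V| * (char_poly M \Po - 'X).
  rewrite char_poly_eigenvalues -/s rmorph_prod /= -size_eigenvalues -/s.
  elim: s => [|l s IHs]; first by rewrite !big_nil mul1r.
  rewrite !big_cons IHs /= comp_polyB comp_polyX comp_polyC polyCN exprS.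
  ring.
pose d (i : 'I_#|V|) : R := (-1) ^+ (enum_val i \in A).
pose D := diag_mx (\row_i (d i)%:P).
have DD : D *m D = 1%:M.
  rewrite mulmx_diag -diag_const_mx; congr diag_mx; apply/rowP => i.
  by rewrite !mxE -polyCM -expr2 sqrr_sign.
pose C := map_mx (comp_poly (- 'X)) (char_poly_mx M).
have DC : D *m C *m D = - char_poly_mx M.
  apply/matrixP => i j; rewrite mul_mx_diag mul_diag_mx !mxE.
  have [-> |ij] := eqVneq i j.
    rewrite adj_irr !mulr1n subr0 comp_polyX mulrC mulrA -polyCM -expr2.
    by rewrite sqrr_sign mul1r.
  rewrite !mulr0n !sub0r opprK -polyCN comp_polyC -!polyCM; congr _%:P.
  case: (boolP (adj G _ _)) => [/bip|_]; last by rewrite oppr0 mulr0 mul0r.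
  by rewrite /d; case: (_ \in A); case: (_ \in A) => //= _; ring.
have : \det (D *m C *m D) = char_poly M \Po - 'X.
  rewrite !det_mulmx mulrAC -det_mulmx DD det1 mul1r.
  by rewrite /C det_map_mx.
have dN : \det (- char_poly_mx M) = (-1) ^+ #|V| * char_poly M.
  by rewrite -scaleN1r detZ.
by rewrite mN DC dN => <-; rewrite mulrA -exprMn mulrNN mulr1 expr1n mul1r.
Qed.

Lemma phi_prod (x : R[i]) :
  (phi R G).[x] = \prod_(l <- eigenvalues R G) (x - l%:C%C).
Proof.
have -> : phi R G = map_poly (real_complex R) (char_poly (adjmx R G)).
  rewrite map_char_poly /phi; congr char_poly.
  by apply/matrixP => i j; rewrite !mxE rmorph_nat.
rewrite char_poly_eigenvalues rmorph_prod horner_prod; apply: eq_bigr => l _.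
by rewrite /= map_polyXsubC hornerXsubC.
Qed.

(** Compare the factors i z - l with i z sqrt (1 + (l / z)^2): they agree at
    l = 0, and the product over a pair l, -l is -(z^2 + l^2) in both cases. This
    fixes the sign of the square root, which the identity for |phi| alone would
    leave open. *)
Lemma phi_imaginary (z : R) : bipartite G -> 0 < z ->
  (phi R G).[(0 +i* z)%C] = (0 +i* z)%C ^+ #|V| *
    (expR (\sum_(l <- eigenvalues R G) ln (1 + (`|l| / z) ^+ 2) / 2))%:C%C.
Proof.
move=> bip z0; rewrite phi_prod -size_eigenvalues.
pose H (l : R) : R[i] := (0 +i* z)%C * (expR (ln (1 + (`|l| / z) ^+ 2) / 2))%:C%C.
rewrite (@big_opp_closed _ _ _ _ H (eigenvalues_opp bip)).
- rewrite big_split /= big_const_seq count_predT iter_mulr_1.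
  by rewrite expR_sum rmorph_prod.
- by rewrite /H normr0 mul0r expr0n addr0 ln1 mul0r expR0 mulr1 subr0.
- move=> l l0; rewrite /H normrN.
  set e := ln _ / 2.
  have ee : expR e * expR e = 1 + (`|l| / z) ^+ 2.
    by rewrite -expRD -splitr lnK// posrE ltr_wpDr// sqr_ge0.
  rewrite mulrACA -[_%:C%C * _%:C%C]rmorphM ee.
  apply/eqP; rewrite eq_complex /=; apply/andP; split; apply/eqP.
    by rewrite (gtr0_norm l0); field; rewrite gt_eqF.
  by ring.
Qed.

End Spectrum.

(** The powers of i z cancel because both graphs have the same number of
    vertices. *)
Lemma phi_ratio (R : realType) (V1 V2 : finType) (G1 : sgraph V1)
    (G2 : sgraph V2) (z : R) :
  #|V1| = #|V2| -> bipartite G1 -> bipartite G2 -> 0 < z ->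
  ln (complex.Re ((phi R G1).[(0 +i* z)%C] / (phi R G2).[(0 +i* z)%C])) =
  \sum_(l <- eigenvalues R G1) ln (1 + (`|l| / z) ^+ 2) / 2 -
  \sum_(l <- eigenvalues R G2) ln (1 + (`|l| / z) ^+ 2) / 2.
Proof.
move=> V12 b1 b2 z0; rewrite !phi_imaginary// V12.
have iz0 : (0 +i* z)%C ^+ #|V2| != 0.
  by rewrite expf_neq0// eq_complex /= negb_and (gt_eqF z0) orbT.
by rewrite -mulf_div divff// mul1r -fmorphV -rmorphM /= -expRN -expRD expRK.
Qed.

(** * The energy formula *)

Lemma has_int_energy_kernel_norm (R : realType) (p l : R) : 0 < p < 2 ->
  has_int (@lebesgue_measure R) `]0, +oo[ (energy_kernel p `|l|)
    (`|l| `^ p * (pi / (p * sin (p * pi / 2)))).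
Proof.
move=> p02; have [->|l0] := eqVneq l 0; last first.
  by apply: has_int_energy_kernel; rewrite ?normr_gt0.
have p0 : p != 0 by rewrite gt_eqF//; case/andP: p02.
rewrite normr0 powR0// mul0r.
have H := @has_int0 _ _ _ (@lebesgue_measure R) `]0, +oo[%classic
  (measurable_itv _).
apply: eq_has_int _ _ H => // z _.
by rewrite /energy_kernel mul0r expr0n addr0 ln1 mulr0.
Qed.

Theorem theorem3 (R : realType) (n : nat) (V1 V2 : finType)
    (G1 : sgraph V1) (G2 : sgraph V2)
    (cardV1 : #|V1| = (2 * n)%N) (cardV2 : #|V2| = (2 * n)%N)
    (bipG1 : bipartite G1) (bipG2 : bipartite G2)
    (p : R) (p_gt0 : 0 < p) (p_lt2 : p < 2) :
  (schatten_energy p G1 - schatten_energy p G2)%:E =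
  ((2 * p * sin (p * pi / 2) / pi)%:E *
    \int[@lebesgue_measure R]_(z in `]0%R, +oo[)
      (z `^ (p - 1) *
       ln (complex.Re ((phi R G1).[(0 +i* z)%C] / (phi R G2).[(0 +i* z)%C])))%:E)%E.
Proof.
have p02 : 0 < p < 2 by rewrite p_gt0.
pose K := pi / (p * sin (p * pi / 2)).
have half (V : finType) (G : sgraph V) : has_int (@lebesgue_measure R) `]0, +oo[
    (fun z => \sum_(l <- eigenvalues R G) 2^-1 * energy_kernel p `|l| z)
    (\sum_(l <- eigenvalues R G) 2^-1 * (`|l| `^ p * K)).
  apply: has_int_sum => // l; apply: has_intZ => //.
  exact: has_int_energy_kernel_norm.
have H : has_int (@lebesgue_measure R) `]0, +oo[ (fun z => z `^ (p - 1) *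
    ln (complex.Re ((phi R G1).[(0 +i* z)%C] / (phi R G2).[(0 +i* z)%C])))
    (\sum_(l <- eigenvalues R G1) 2^-1 * (`|l| `^ p * K) -
     \sum_(l <- eigenvalues R G2) 2^-1 * (`|l| `^ p * K)).
  apply: eq_has_int _ _ (has_intB _ (half V1 G1) (half V2 G2)) => // z /=.
  rewrite in_itv/= andbT => z0.
  rewrite phi_ratio ?cardV1 ?cardV2// mulrBr !mulr_sumr.
  by congr (_ - _); apply: eq_bigr => l _; rewrite /energy_kernel mulrC mulrA.
rewrite H.2 -EFinM; congr EFin.
rewrite -!mulr_sumr -!mulr_suml -/(schatten_energy p G1) -/(schatten_energy p G2).
have s0 : sin (p * pi / 2) != 0.
  rewrite gt_eqF// sin_gt0_pi//; have := pi_gt0 R; nra.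
rewrite /K; move: (sin _) s0 => S S0.
move: (@pi R) (lt0r_neq0 (pi_gt0 R)) => P P0.
by field; rewrite S0 P0 gt_eqF.
Qed.
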